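(* Let $\mathbf{f}$ be the Fibonacci word and let $\mathbf{cubes_f}$ be the infinite binary word whose $n$-th term ($n\ge 0$) is $1$ if a cube ends at position $n$ of $\mathbf{f}$ and $0$ otherwise. Then the density of $0$'s in $\mathbf{cubes_f}$ is zero, i.e., \[ \lim_{N\to\infty}\frac{\#\{0\le n<N : \text{the $n$-th term of } \mathbf{cubes_f} \text{ is } 0\}}{N}=0. \]
   Context: The Fibonacci word is $\mathbf{f}=010010100100101001010010\cdots$, the fixed point of the morphism $0\mapsto 01$, $1\mapsto 0$; its letters are indexed starting from position $0$, and $\mathbf{f}[a..b]$ denotes the factor occupying positions $a$ through $b$. A cube is a word of the form $xxx$ with $x$ nonempty. A cube ends at position $j$ of $\mathbf{f}$ if there exist $i\ge 0$ and $m\ge 1$ with $j=i+3m-1$ such that $\mathbf{f}[i..j]=xxx$ for some word $x$ of length $m$. *)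

(* Defs.v *)
From mathcomp Require Import all_boot all_order all_algebra.
From mathcomp Require Import all_classical all_reals all_analysis.
From mathcomp Require Import zify.

Set Implicit Arguments.
Unset Strict Implicit.
Unset Printing Implicit Defensive.

(* The binary alphabet {0, 1} is bool, with false = 0 and true = 1; a finite
   word over T is a seq T and an infinite word, indexed from 0, is nat -> T. *)

Section Words.
Variable T : eqType.

Definition factor (w : nat -> T) (a b : nat) : seq T :=
  [seq w k | k <- iota a (b.+1 - a)].

Definition morph_ext (phi : T -> seq T) (u : seq T) : seq T :=
  flatten [seq phi a | a <- u].

(* phi maps every prefix of w to a prefix of w: for a nonerasing phi this is
   the equation phi(w) = w between infinite words. *)
Definition fixed_point (phi : T -> seq T) (w : nat -> T) : Prop :=
  forall n, let u := morph_ext phi (mkseq w n) in u = mkseq w (size u).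

Definition cube_ends_at (w : nat -> T) (j : nat) : Prop :=
  exists i m : nat, [/\ (1 <= m)%N, j = (i + 3 * m - 1)%N &
    exists2 x : seq T, size x = m & factor w i j = x ++ x ++ x].

Definition cubes (w : nat -> T) (n : nat) : bool := `[< cube_ends_at w n >].

End Words.

Definition fib_morph (a : bool) : seq bool :=
  if a then [:: false] else [:: false; true].

Definition fib_approx (n : nat) : seq bool :=
  iter n (morph_ext fib_morph) [:: false].

(* fib_approx n is a prefix of fib_approx n.+1 and has length > n; their limit
   is the unique fixed point of fib_morph, see fib_word_fixed and
   fib_word_unique. *)
Definition fib_word (n : nat) : bool :=
  nth false (fib_approx n) n.

Lemma morph_ext_cat (T : eqType) (phi : T -> seq T) (u v : seq T) :
  morph_ext phi (u ++ v) = morph_ext phi u ++ morph_ext phi v.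
Proof. by rewrite /morph_ext map_cat flatten_cat. Qed.

Lemma fib_approxS (n : nat) :
  fib_approx n.+1 = morph_ext fib_morph (fib_approx n).
Proof. by []. Qed.

Lemma fib_approx_prefix (n k : nat) :
  prefix (fib_approx n) (fib_approx (n + k)).
Proof.
have step m : prefix (fib_approx m) (fib_approx m.+1).
  elim: m => [|m /prefixP[s IH]]; first by [].
  by rewrite (fib_approxS m.+1) IH morph_ext_cat -IH -fib_approxS prefix_prefix.
elim: k => [|k IH]; first by rewrite addn0 prefix_refl.
by rewrite addnS; apply: prefix_trans IH (step _).
Qed.

Lemma size_morph_fib (u : seq bool) :
  size (morph_ext fib_morph u) = (size u + count_mem false u)%N.
Proof.
elim: u => // a u IH; rewrite -cat1s morph_ext_cat !size_cat IH count_cat.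
by case: a => /=; lia.
Qed.

Lemma size_fib_approx (n : nat) :
  (n < size (fib_approx n))%N.
Proof.
elim: n => // n IH; rewrite fib_approxS size_morph_fib.
have /prefixP[s Es] := fib_approx_prefix 0 n.
rewrite add0n in Es; rewrite -addn1 leq_add // Es.
by rewrite count_cat /= addnC ltn_addl.
Qed.

Lemma mkseq_fib_word (n : nat) :
  mkseq fib_word n = take n (fib_approx n).
Proof.
have sz := size_fib_approx n.
apply: (@eq_from_nth _ false).
  by rewrite size_mkseq size_take sz.
move=> i; rewrite size_mkseq => lt_in; rewrite nth_mkseq // nth_take //.
have /prefixP[s Es] := fib_approx_prefix i (n - i).
rewrite subnKC in Es; last exact: ltnW.
by rewrite Es nth_cat size_fib_approx.
Qed.

Lemma fib_word_fixed : fixed_point fib_morph fib_word.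
Proof.
move=> n u; set N := size u.
set F := fib_approx.
have FP k l : (k <= l)%N -> prefix (F k) (F l).
  by move=> /subnKC <-; apply: fib_approx_prefix.
have pu : prefix u (F n.+1).
  rewrite /u mkseq_fib_word /F fib_approxS -/(F n).
  by rewrite -{2}(cat_take_drop n (F n)) morph_ext_cat prefix_prefix.
have pu' : prefix u (F (n.+1 + N)) by apply: prefix_trans pu (FP _ _ _); lia.
have pN : prefix (F N) (F (n.+1 + N)) by apply: FP; lia.
rewrite mkseq_fib_word -/(F N).
have sN : (N <= size (F N))%N by apply: ltnW; apply: size_fib_approx.
have /prefixP[s1 E1] := pu'; have /prefixP[s2 E2] := pN.
have := congr1 (take N) E2; rewrite {1}E1 take_size_cat // takel_cat //.
Qed.

Lemma fib_word_unique (w : nat -> bool) :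
  fixed_point fib_morph w -> w =1 fib_word.
Proof.
move=> hw n; set F := fib_approx.
have hF k : F k = mkseq w (size (F k)).
  elim: k => [|k IH].
    have := hw 1%N; rewrite /mkseq /= /morph_ext /=.
    by case E: (w 0%N) => /=; rewrite /mkseq /= ?E.
  have := hw (size (F k)); rewrite /= -IH.
  by rewrite -[morph_ext _ _]/(F k.+1).
have sz := size_fib_approx n.
by rewrite /fib_word -/(F n) hF nth_mkseq.
Qed.

(* Main.v *)
(* Write A_n for the n-th iterate of the morphism on 0, so that
   A_(n+2) = A_(n+1) A_n, and put Q = A_k, P = A_(k+1), Y = A_(k+2) = PQ,
   X = A_(k+3) = PQP.  Then A_(k+7) = XY XXYX YX, and XXYX = XXY PQP = XXX QP.
   Since Q is a prefix of X, a cube of period |X| ends at each letter of that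
   occurrence of Q.  The other blocks of A_(k+7) are copies of X, Y and P, so
   going from level k to level k + 7 multiplies the proportion of letters at which
   no cube ends by at most 1 - |A_k| / |A_(k+7)| <= 127/128.  An
   arbitrary prefix of the Fibonacci word is a concatenation of A_n's of high
   level followed by a remainder of bounded length. *)
Require Import Defs.
From mathcomp Require Import all_boot all_order all_algebra.
From mathcomp Require Import all_classical all_reals all_analysis.
From mathcomp Require Import zify lra.
Import Order.TTheory GRing.Theory Num.Theory.
Import numFieldNormedType.Exports.

Set Implicit Arguments.
Unset Strict Implicit.
Unset Printing Implicit Defensive.

Section CubeFreeEnds.
Variable T : eqType.
Implicit Types c d u v w x : seq T.

Definition has_cube_suffix w : bool :=
  `[< exists v x, x <> [::] /\ w = v ++ x ++ x ++ x >].

(* The word c is a left context: the cubes may start in c. *)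
Fixpoint cubefree_ends c w : nat :=
  if w is a :: w' then
    (~~ has_cube_suffix (rcons c a) + cubefree_ends (rcons c a) w')%N
  else 0%N.

Lemma has_cube_suffix_catl c w :
  has_cube_suffix w -> has_cube_suffix (c ++ w).
Proof.
move=> /asboolP[v [x [x0 ->]]]; apply/asboolP.
by exists (c ++ v), x; rewrite catA.
Qed.

Lemma cubefree_ends_cat c u v :
  cubefree_ends c (u ++ v) =
  (cubefree_ends c u + cubefree_ends (c ++ u) v)%N.
Proof.
elim: u c => [|a u IH] c /=; first by rewrite cats0.
by rewrite IH -cats1 -catA /= addnA.
Qed.

(** Extra left context only creates further cubes. This is what allows each block of a concatenation
    to be bounded in isolation. *)
Lemma cubefree_ends_catl c d w :
  (cubefree_ends (c ++ d) w <= cubefree_ends d w)%N.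
Proof.
elim: w d => //= a w IH d.
rewrite rcons_cat leq_add //; have := @has_cube_suffix_catl c (rcons d a).
by case: has_cube_suffix => [->|_] //; case: has_cube_suffix.
Qed.

Lemma cubefree_ends_nil c w : (cubefree_ends c w <= cubefree_ends [::] w)%N.
Proof. by rewrite -{1}[c]cats0 cubefree_ends_catl. Qed.

Lemma cubefree_ends_cat_le u v :
  (cubefree_ends [::] (u ++ v) <=
   cubefree_ends [::] u + cubefree_ends [::] v)%N.
Proof. by rewrite cubefree_ends_cat leq_add2l cubefree_ends_nil. Qed.

Lemma cubefree_ends_size c w : (cubefree_ends c w <= size w)%N.
Proof.
elim: w c => //= a w IH c.
by have := IH (rcons c a); case: has_cube_suffix => /=; lia.
Qed.

Lemma cubefree_ends_cube c x u :
  prefix u x -> cubefree_ends (c ++ x ++ x ++ x) u = 0%N.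
Proof.
move=> /prefixP[z ->].
(* A cube followed by a prefix u1 of its root (u1 z) ends in the cube of the
   conjugate root (z u1). *)
have conj u1 z1 : u1 ++ z1 <> [::] ->
    has_cube_suffix (c ++ (u1 ++ z1) ++ (u1 ++ z1) ++ (u1 ++ z1) ++ u1).
  move=> nz; apply/asboolP; exists (c ++ u1), (z1 ++ u1); split.
    by move: nz; case: z1 => //; rewrite cats0.
  by rewrite !catA.
(* Here [u1] is the part of the fourth copy already read and [u2] the part still to be read; the
   induction moves letters from [u2] to [u1]. *)
suff gen u1 u2 : cubefree_ends
    (c ++ (u1 ++ u2 ++ z) ++ (u1 ++ u2 ++ z) ++ (u1 ++ u2 ++ z) ++ u1) u2 = 0%N.
  by have := gen [::] u; rewrite /= cats0.
elim: u2 u1 => //= a u2 IH u1.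
have e : u1 ++ a :: u2 ++ z = rcons u1 a ++ u2 ++ z by rewrite -cats1 -catA.
rewrite !rcons_cat e IH addn0 conj //.
by case: (u1).
Qed.

End CubeFreeEnds.

Lemma has_cube_suffix_cubes (T : eqType) (w : nat -> T) n :
  has_cube_suffix (mkseq w n.+1) -> cubes w n.
Proof.
move=> /asboolP[v [x [x0 e]]]; apply/asboolP; exists (size v), (size x).
have sz := congr1 size e; rewrite size_mkseq !size_cat in sz.
split; first by case: (x) x0.
  by lia.
exists x => //.
rewrite /factor -(drop_size_cat (x ++ x ++ x) (erefl (size v))) -e.
by rewrite /mkseq -map_drop drop_iota add0n.
Qed.

(** Passes from the infinite word to its prefixes: a cube that is a suffix of the prefix of length
    [n.+1] ends at position [n]. *)
Lemma count_cubes_le (T : eqType) (w : nat -> T) N :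
  (count [pred n | cubes w n == false] (iota 0 N) <=
   cubefree_ends [::] (mkseq w N))%N.
Proof.
elim: N => // N IH; rewrite -addn1 iotaD count_cat /= addn1.
rewrite mkseqS -cats1 cubefree_ends_cat leq_add // !addn0 /=.
rewrite -mkseqS add0n.
have := @has_cube_suffix_cubes _ w N.
by case: has_cube_suffix => [->|_] //; case: (cubes w N).
Qed.

Lemma fib_approxSS n : fib_approx n.+2 = fib_approx n.+1 ++ fib_approx n.
Proof.
elim: n => // n IH.
by rewrite (fib_approxS n.+2) {1}IH morph_ext_cat -!fib_approxS.
Qed.

Lemma size_fib_approxS_le n :
  (size (fib_approx n.+1) <= 2 * size (fib_approx n))%N.
Proof.
by rewrite fib_approxS size_morph_fib mul2n -addnn leq_add2l count_size.
Qed.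

(** The coefficients count the blocks X, Y and P in A_(k+7); the single remaining block Q
    contributes nothing. *)
Lemma cubefree_ends_fib_approx k
    (a := fun n => cubefree_ends [::] (fib_approx n)) :
  (a k.+4.+3 <= 4 * a k.+3 + 3 * a k.+2 + 2 * a k.+1)%N.
Proof.
pose Q := fib_approx k; pose P := fib_approx k.+1.
pose Y := fib_approx k.+2; pose X := fib_approx k.+3.
pose u : seq bool -> nat := cubefree_ends [::].
have uD (v w : seq bool) : (u (v ++ w) <= u v + u w)%N.
  exact: cubefree_ends_cat_le.
have eX : X = P ++ Q ++ P by rewrite /X !fib_approxSS catA.
pose M := X ++ X ++ Y ++ P ++ Q ++ P.
have eA : fib_approx k.+4.+3 = X ++ Y ++ M ++ Y ++ X.
  rewrite /M -eX /X /Y (fib_approxSS k.+4.+1) (fib_approxSS k.+4).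
  by rewrite (fib_approxSS k.+3) (fib_approxSS k.+2) -!catA.
have QX : prefix Q X by rewrite /X -addn3; apply: fib_approx_prefix.
have uM : (u M <= 2 * u X + u Y + 2 * u P)%N.
  have eXXX : X ++ X ++ Y ++ P = X ++ X ++ X.
    by rewrite {5}eX /Y fib_approxSS -catA.
  (* Only the left context of [Q] is rewritten as the cube XXX; the count before [Q] stays split
     into the blocks X, X, Y, P. *)
  have uQ : (u ((X ++ X ++ Y ++ P) ++ Q) <= u (X ++ X ++ Y ++ P))%N.
    rewrite /u cubefree_ends_cat {2}eXXX.
    by rewrite (cubefree_ends_cube [::] QX) addn0.
  have -> : M = ((X ++ X ++ Y ++ P) ++ Q) ++ P by rewrite /M -!catA.
  have := uD ((X ++ X ++ Y ++ P) ++ Q) P.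
  have := uD X (X ++ Y ++ P); have := uD X (Y ++ P); have := uD Y P.
  by lia.
rewrite /a eA -/X -/Y -/P -!/(u _).
have := uD X (Y ++ M ++ Y ++ X); have := uD Y (M ++ Y ++ X).
have := uD M (Y ++ X); have := uD Y X.
by lia.
Qed.

(** Each seven levels gain one factor 127/128, by induction on [K]; denominators are cleared to stay
    in the natural numbers. *)
Lemma cubefree_ends_fib_approx_ratio K m : (7 * K <= m)%N ->
  (128 ^ K * cubefree_ends [::] (fib_approx m) <=
   127 ^ K * size (fib_approx m))%N.
Proof.
elim: K m => [|K IH] m; first by rewrite !mul1n cubefree_ends_size.
move=> le_m; have [k em] : exists k, m = k.+4.+3 by exists (m - 7)%N; lia.
subst m; have rec := cubefree_ends_fib_approx k.
have h1 : (7 * K <= k.+1)%N by lia.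
have {}h1 := IH _ h1.
have h2 : (7 * K <= k.+2)%N by lia.
have {}h2 := IH _ h2.
have h3 : (7 * K <= k.+3)%N by lia.
have {}h3 := IH _ h3.
have sS n : size (fib_approx n.+2) =
    (size (fib_approx n.+1) + size (fib_approx n))%N.
  by rewrite fib_approxSS size_cat.
have := size_fib_approxS_le k.
move: (sS k) (sS k.+1) (sS k.+2) (sS k.+3) (sS k.+4) (sS k.+4.+1).
rewrite !expnS; move: (expn 128 K) (expn 127 K) h1 h2 h3 rec => D C.
set u1 := cubefree_ends _ (fib_approx k.+1).
set u2 := cubefree_ends _ (fib_approx k.+2).
set u3 := cubefree_ends _ (fib_approx k.+3).
set u7 := cubefree_ends _ (fib_approx k.+4.+3).
set a0 := size (fib_approx k); set a1 := size (fib_approx k.+1).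
set a2 := size (fib_approx k.+2); set a3 := size (fib_approx k.+3).
set a7 := size (fib_approx k.+4.+3).
move=> h1 h2 h3 rec e2 e3 e4 e5 e6 e7 le_a1.
have ea : a7 = (4 * a3 + 3 * a2 + 2 * a1 + a0)%N by lia.
(* Since [a7] = 13 [a1] + 8 [a0] and [a1] <= 2 [a0], even 34 [a0] would do; 128 is the cruder bound
   from seven doublings. *)
have le_a : (a7 <= 128 * a0)%N by lia.
have le1 : (D * u7 <= C * (4 * a3 + 3 * a2 + 2 * a1))%N.
  apply: leq_trans (_ : D * (4 * u3 + 3 * u2 + 2 * u1) <= _)%N.
    by rewrite leq_mul2l rec orbT.
  by lia.
(* The sum is [a7 - a0], and [a0] is at least [a7] / 128. *)
have le2 : (C * (128 * (4 * a3 + 3 * a2 + 2 * a1)) <= C * (127 * a7))%N.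
  by rewrite leq_mul2l; apply/orP; right; lia.
by lia.
Qed.

(** A prefix of A_(m+2) = A_(m+1) A_m either lies in A_(m+1) or is A_(m+1) followed by a prefix of
    A_m. Peeling off such blocks while the level is high leaves a remainder bounded by its
    length. *)
Lemma cubefree_ends_prefix K n w : prefix w (fib_approx n) ->
  (128 ^ K * cubefree_ends [::] w <=
   127 ^ K * size w + 128 ^ K * size (fib_approx (7 * K).+1))%N.
Proof.
set B := size (fib_approx (7 * K).+1).
elim/ltn_ind: n w => n IH w pw.
(* The successor in the threshold ensures [n >= 2] in the second case, even for [K = 0]. *)
have [le_n|lt_n] := leqP n (7 * K).+1.
  apply: leq_trans (leq_addl _ _); rewrite leq_mul2l; apply/orP; right.
  apply: leq_trans (cubefree_ends_size _ _) _.
  apply: leq_trans (size_prefix pw) _.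
  by apply: size_prefix; rewrite -(subnKC le_n) fib_approx_prefix.
have [m em] : exists m, n = m.+2 by exists (n - 2)%N; lia.
subst n; move: pw; rewrite prefixE fib_approxSS take_cat.
case: ltnP => _ /eqP ew.
  by apply: (IH m.+1) => //; rewrite -ew prefix_take.
move: ew; set w' := take _ _ => <-.
have pw' : prefix w' (fib_approx m) by exact: prefix_take.
have le_m : (7 * K <= m.+1)%N by lia.
apply: leq_trans (leq_mul (leqnn _) (cubefree_ends_cat_le _ _)) _.
rewrite size_cat !mulnDr -addnA leq_add //.
  exact: cubefree_ends_fib_approx_ratio.
exact: (IH m (leqnSn _)).
Qed.

Lemma count_cubes_fib_word_le K N :
  (128 ^ K * count [pred n | cubes fib_word n == false] (iota 0 N) <=
   127 ^ K * N + 128 ^ K * size (fib_approx (7 * K).+1))%N.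
Proof.
apply: leq_trans (_ : 128 ^ K * cubefree_ends [::] (mkseq fib_word N) <= _)%N.
  by rewrite leq_mul2l count_cubes_le orbT.
rewrite -{2}(size_mkseq fib_word N); apply: (@cubefree_ends_prefix _ N).
by rewrite mkseq_fib_word prefix_take.
Qed.

Local Open Scope classical_set_scope.
Local Open Scope ring_scope.

Theorem theorem4 (R : realType) :
  ((count [pred n | cubes fib_word n == false] (iota 0 N))%:R / N%:R : R)
    @[N --> \oo] --> (0 : R).
Proof.
apply/cvgrPdist_lt => e e0.
have q1 : `|127 / 128 : R| < 1 by rewrite ger0_norm; lra.
(* First [K] is fixed so that (127/128)^K < [e / 2]; only then is [N] taken large enough for the
   constant [B], which depends on [K], to be below [e / 2 * N]. *)
have /cvgrPdist_lt/(_ (e / 2)) := cvg_expr q1.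
case=> [|K _ /(_ K (leqnn K)) /=]; first by lra.
rewrite sub0r normrN ger0_norm ?exprn_ge0; [|lra..] => qK.
set B := size (fib_approx (7 * K).+1).
near=> N.
have N0 : (0 < N%:R :> R) by rewrite ltr0n; near: N; exact: nbhs_infty_gt.
rewrite sub0r normrN ger0_norm ?divr_ge0 // ltr_pdivrMr //.
set c := count _ _.
have le_c : (c%:R : R) <= (127 / 128) ^+ K * N%:R + B%:R.
  have := count_cubes_fib_word_le K N; rewrite -/B -/c -(ler_nat R).
  rewrite natrD !natrM !natrX => h.
  have D0 : 0 < 128%:R ^+ K :> R by rewrite exprn_gt0.
  rewrite -(ler_pM2l D0); apply: le_trans h _.
  by rewrite mulrDr mulrA -exprMn mulrCA divff ?mulr1.
have le_B : B%:R < e / 2 * N%:R.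
  rewrite mulrC -ltr_pdivrMr; last by lra.
  by near: N; exact: nbhs_infty_gtr.
apply: le_lt_trans le_c _.
have : (127 / 128) ^+ K * N%:R < e / 2 * N%:R by rewrite ltr_pM2r.
by lra.
Unshelve. all: by end_near.
Qed.
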